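(* Let $H$ be a finite digraph. If $H$ contains an induced unbalanced oriented cycle of net length greater than one, then $H$ does not admit a Min-Max ordering.
   Context: A linear ordering $<$ of $V(H)$ is a Min-Max ordering if for all vertices $i,j,s,r$: $i<j$, $s<r$ and $ir, js \in A(H)$ imply $is,jr \in A(H)$. An oriented cycle is a subdigraph whose underlying graph is a cycle (a loop being a cycle of length one); traversing it once, its net length is the number of arcs traversed forward minus the number traversed backward, with the direction chosen so this is non-negative. It is unbalanced if its net length is nonzero, and induced if $H$ has no arcs (including loops) on its vertices other than the arcs of the cycle. *)

(* Defs.v *)
From mathcomp Require Import all_boot all_order all_algebra.

Set Implicit Arguments.
Unset Strict Implicit.
Unset Printing Implicit Defensive.

(* A finite digraph is a relation [A] on a finType [V]: [A x y] means that xy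
   is an arc.  Loops are allowed. *)

Definition strict_linear_order (V : finType) (lt : rel V) : Prop :=
  [/\ irreflexive lt, transitive lt & forall x y, x != y -> lt x y || lt y x].

Definition min_max_ordering (V : finType) (A lt : rel V) : Prop :=
  strict_linear_order lt /\
  forall i j s r : V, lt i j -> lt s r -> A i r -> A j s -> A i s /\ A j r.

(* One traversal of an oriented cycle is a list of steps: the k-th step goes
   from the vertex [(nth _ c k).1] to the vertex of the next step (cyclically),
   along an arc traversed forward if [(nth _ c k).2], and backward otherwise. *)
Definition cycle_verts (V : finType) (c : seq (V * bool)) : seq V := unzip1 c.

Definition cycle_arcs (V : finType) (c : seq (V * bool)) : seq (V * V) :=
  [seq if p.1.2 then (p.1.1, p.2) else (p.2, p.1.1)
     | p <- zip c (rot 1 (cycle_verts c))].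

(* The arcs are required to be distinct so that going back and forth along a
   single arc is not a cycle; this matters only when [c] has two steps.  A cycle
   of length one is a loop, and one of length two is a pair of opposite arcs. *)
Definition oriented_cycle (V : finType) (A : rel V) (c : seq (V * bool)) : Prop :=
  [/\ c != [::], uniq (cycle_verts c), uniq (cycle_arcs c)
    & {in cycle_arcs c, forall a, A a.1 a.2}].

(* The absolute value selects the direction of traversal with non-negative
   difference: reversing the traversal exchanges forward and backward arcs. *)
Definition net_length (V : finType) (c : seq (V * bool)) : nat :=
  absz (Posz (count (fun p => p.2) c) - Posz (count (fun p => ~~ p.2) c))%R.

Definition unbalanced (V : finType) (c : seq (V * bool)) : Prop :=
  net_length c <> 0.

Definition induced_cycle (V : finType) (A : rel V) (c : seq (V * bool)) : Prop :=
  {in cycle_verts c &, forall x y, A x y -> (x, y) \in cycle_arcs c}.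

(* Main.v *)
(* Give the vertices of the cycle levels modulo its net length k > 1, so that
   arcs raise the level by one.  If two arcs whose tails have distinct levels
   crossed, the Min-Max property would add an arc violating the levels; so the
   order of the tails of such arcs agrees with the order of their heads.
   For a vertex s, count the arcs whose tail is one level above s and greater
   than s in the ordering.  Since every vertex has total degree two, replacing
   tails by heads does not change the parity of this count; with non-crossing,
   the parity is the same at both ends of every arc, hence constant on the
   cycle, and it is even because of the greatest vertex.  Likewise for tails
   smaller than s.  Hence the number of arcs leaving a given level is even.  But
   the signed number of arcs leaving a level is the same for all k levels and
   these sum to +-k, so it is +-1, which is odd. *)
Require Import Defs.
From mathcomp Require Import all_boot all_order all_algebra.
From mathcomp Require Import zify.

Set Implicit Arguments.
Unset Strict Implicit.
Unset Printing Implicit Defensive.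

Import GRing.Theory.

Lemma exists_maximal (T : finType) (x0 : T) (r : rel T) :
  irreflexive r -> transitive r -> exists x, forall y, ~~ r x y.
Proof.
move=> r_irr r_trans.
have [x _ x_max] := @arg_maxnP T x0 xpredT (fun x => #|[set y | r y x]|) isT.
exists x => y; apply/negP => rxy.
have: #|[set z | r z y]| <= #|[set z | r z x]| by apply: x_max.
rewrite leqNgt => /negP; apply; apply: proper_card.
apply/properP; split; last by exists x; rewrite !inE ?rxy ?r_irr.
by apply/subsetP => z; rewrite !inE => /r_trans; apply.
Qed.

(** Positions on the cycle index both its vertices and its steps: step [l] joins [l] to [next l],
    and [d l] says that it is traversed forward. *)
Definition step_tail (T : Type) (next : T -> T) (d : pred T) (l : T) : T :=
  if d l then l else next l.

Definition step_head (T : Type) (next : T -> T) (d : pred T) (l : T) : T :=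
  if d l then next l else l.

Definition step_sign (T : Type) (d : pred T) (l : T) : int :=
  if d l then 1%R else (-1)%R.

(** * Parity and signed counts around a cycle *)

Section CyclicSteps.

Variables (I : finType) (next : I -> I) (d : pred I).
Hypothesis next_inj : injective next.

Let tail := step_tail next d.
Let head := step_head next d.
Let sign := step_sign d.

(** Every vertex is an end of exactly two steps, so the two counts add up to twice [#|P|]. *)
Lemma odd_card_tail_head (P : pred I) :
  odd #|[pred l | P (tail l)]| = odd #|[pred l | P (head l)]|.
Proof.
have cardE (Q : pred I) : #|Q| = \sum_i (Q i : nat).
  by rewrite -sum1_card big_mkcond.
suff /(congr1 odd) :
    #|[pred l | P (tail l)]| + #|[pred l | P (head l)]| = (#|P|).*2.
  by rewrite oddD odd_double; case: odd; case: odd.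
rewrite !cardE -addnn [X in _ = _ + X](reindex_inj next_inj) -!big_split /=.
apply: eq_bigr => l _; rewrite /tail /head /step_tail /step_head.
by case: (d l) => //; rewrite addnC.
Qed.

Local Open Scope ring_scope.

(** The difference of the two sides telescopes: step [l] contributes [P l - P (next l)] in either
    direction. *)
Lemma sum_sign_tail_head (P : pred I) :
  \sum_(l | P (tail l)) sign l = \sum_(l | P (head l)) sign l.
Proof.
apply/eqP; rewrite -subr_eq0 big_mkcond [X in _ - X]big_mkcond -sumrB /=.
rewrite (eq_bigr (fun l => (P l)%:Z - (P (next l))%:Z)); last first.
  move=> l _; rewrite /tail /head /sign /step_tail /step_head /step_sign.
  by case: (d l); case: (P l); case: (P _).
rewrite sumrB subr_eq0; apply/eqP.
by rewrite [LHS](reindex_inj next_inj).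
Qed.

Lemma odd_sum_sign (P : pred I) : odd (absz (\sum_(l | P l) sign l)) = odd #|P|.
Proof.
rewrite -sum1_card; apply: (big_ind2 (fun (x : int) n => odd (absz x) = odd n)) => //.
  by move=> x m y n; lia.
by move=> l _; rewrite /sign /step_sign; case: (d l).
Qed.

Section Levels.

Variables (k : nat) (lev : I -> 'I_k.+2).
Hypothesis lev_arc : forall l, lev (head l) = lev (tail l) + 1.

Lemma odd_card_level (a : 'I_k.+2) :
  absz (\sum_l sign l) = k.+2 -> odd #|[pred l | lev (tail l) == a]|.
Proof.
move=> net; pose S (b : 'I_k.+2) := \sum_(l | lev (tail l) == b) sign l.
(* The arcs entering level [b + 1] are those leaving level [b]. *)
have S_succ b : S (b + 1) = S b.
  rewrite /S (sum_sign_tail_head (fun i => lev i == b + 1)).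
  by apply: eq_bigl => l; rewrite lev_arc (inj_eq (addIr 1)).
have S_const b : S b = S 0.
  rewrite -(natr_Zp b); elim: (nat_of_ord b) => // m IHm.
  by rewrite -natr1 S_succ IHm.
have sumS : \sum_l sign l = S 0 *+ k.+2.
  rewrite (partition_big (fun l => lev (tail l)) xpredT) //=.
  rewrite (eq_bigr (fun=> S 0)) => [|b _]; last exact: S_const.
  by rewrite sumr_const card_ord.
rewrite -odd_sum_sign -/(S a) S_const.
have : (absz (S 0%R) * k.+2 = 1 * k.+2)%N.
  by rewrite mul1n -[RHS]net sumS -mulr_natr abszM natz.
by move/eqP; rewrite eqn_pmul2r // => /eqP ->.
Qed.

Variable r : rel I.
Hypothesis r_arc : forall l m, lev (tail l) != lev (tail m) ->
  r (tail l) (tail m) = r (head l) (head m).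

Let above s := [pred l | (lev (tail l) == lev s + 1) && r s (tail l)].

Lemma odd_card_above_next l : odd #|above (next l)| = odd #|above l|.
Proof.
have arcE : odd #|above (tail l)| = odd #|above (head l)|.
  rewrite [RHS](odd_card_tail_head
    (fun i => (lev i == lev (head l) + 1) && r (head l) i)).
  congr odd; apply: eq_card => m; rewrite !inE !lev_arc.
  rewrite (inj_eq (addIr 1)); case: eqP => //= levm.
  (* The two tails lie on consecutive levels, which differ because there are at least two levels. *)
  by rewrite r_arc // levm -subr_eq0 opprD addNKr oppr_eq0 oner_eq0.
by move: arcE; rewrite /tail /head /step_tail /step_head; case: (d l).
Qed.

Lemma odd_card_above : irreflexive r -> transitive r ->
  (forall s t, fconnect next s t) -> forall s, ~~ odd #|above s|.
Proof.
move=> r_irr r_trans next_conn s.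
have [x x_max] := exists_maximal s r_irr r_trans.
have /iter_findex <- := next_conn x s.
elim: (findex _ _ _) => [|j IHj] /=; last by rewrite odd_card_above_next.
rewrite eq_card0 // => l; rewrite !inE; apply/negbTE.
by rewrite negb_and x_max orbT.
Qed.

End Levels.

End CyclicSteps.

(** * Application to the cycle of the digraph *)

Lemma fconnect_ordS n (i j : 'I_n) : fconnect (@ordS n) i j.
Proof.
have iterE m : iter m (@ordS n) i = (i + m) %% n :> nat.
  elim: m => [|m IHm] /=; first by rewrite addn0 modn_small.
  by rewrite IHm addnS -[in LHS]addn1 modnDml addn1.
(* Going on to the end and then [j] steps further avoids the truncated subtraction [j - i]. *)
suff <- : iter (n - i + j) (@ordS n) i = j by apply: fconnect_iter.
apply: val_inj; rewrite /= iterE addnA subnKC ?(ltnW (ltn_ord i)) //.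
by rewrite modnDl modn_small.
Qed.

Lemma cycle_arcsP (V : finType) (p : V * bool) (c : seq (V * bool)) x y :
  let v (i : 'I_(size c)) := (nth p c i).1 in
  let d (i : 'I_(size c)) := (nth p c i).2 in
  reflect (exists l, (x, y) = (v (step_tail (@ordS _) d l),
                               v (step_head (@ordS _) d l)))
    ((x, y) \in cycle_arcs c).
Proof.
move=> v d; set n := size c in v d *.
have sizeE : size (zip c (rot 1 (cycle_verts c))) = n.
  by rewrite size_zip size_rot size_map minnn.
have nthE (i : 'I_n) :
    nth (p, p.1) (zip c (rot 1 (cycle_verts c))) i = (nth p c i, v (ordS i)).
  rewrite nth_zip; last by rewrite size_rot size_map.
  congr pair; rewrite /v /= /cycle_verts /n; case: c @n @v @d sizeE i => [|q c] n v d _ i.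
    by case: i.
  rewrite /= rot1_cons nth_rcons size_map.
  (* At the last position both [rot 1] and [ordS] wrap around to the first vertex. *)
  have := ltn_ord i; rewrite {2}/n /= ltnS leq_eqVlt => /predU1P [->|lt_i].
    by rewrite ltnn eqxx modnn.
  by rewrite lt_i modn_small //= (nth_map p).
have arcE (i : 'I_n) : (if d i then (v i, v (ordS i)) else (v (ordS i), v i)) =
    (v (step_tail (@ordS _) d i), v (step_head (@ordS _) d i)).
  by rewrite /step_tail /step_head; case: (d i).
apply: (iffP mapP) => [[a /(nthP (p, p.1)) [i]] | [l ->]].
  rewrite sizeE => lt_i <- ->; exists (Ordinal lt_i).
  by rewrite -arcE (nthE (Ordinal lt_i)).
exists (nth p c l, v (ordS l)); last by rewrite -arcE.
by rewrite -nthE mem_nth // sizeE.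
Qed.

Lemma net_lengthE (V : finType) (p : V * bool) (c : seq (V * bool)) :
  net_length c =
  absz (\sum_(l < size c) step_sign (fun i : 'I_(size c) => (nth p c i).2) l)%R.
Proof.
rewrite /net_length; congr absz.
rewrite (eq_bigr (fun i : 'I_(size c) =>
  (if (nth p c i).2 then 1 else -1)%R : int)) //.
rewrite -(big_mkord xpredT (fun i => (if (nth p c i).2 then 1 else -1)%R : int)).
rewrite -(big_nth p xpredT (fun q => (if q.2 then 1 else -1)%R : int)).
elim: c => [|[v b] c IHc]; first by rewrite big_nil.
by rewrite big_cons -IHc /=; case: b => /=; lia.
Qed.

(** The level of a vertex is the signed sum of the steps before it, modulo [k.+2]. It is consistent
    where the cycle closes, since the total is [k.+2] up to sign. *)
Lemma exists_levels n k (d : pred 'I_n) :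
  absz (\sum_l step_sign d l)%R = k.+2 ->
  exists lev : 'I_n -> 'I_k.+2, forall l,
    lev (step_head (@ordS n) d l) = (lev (step_tail (@ordS n) d l) + 1)%R.
Proof.
move=> net.
pose F (m : nat) : 'I_k.+2 :=
  (\sum_(j < n | (j < m)%N) (step_sign d j)%:~R)%R.
have FS (l : 'I_n) : F l.+1 = (F l + (step_sign d l)%:~R)%R.
  rewrite /F (bigD1 l) //= [RHS]addrC; congr (_ + _)%R.
  by apply: eq_bigl => j; rewrite ltnS andbC -ltn_neqAle.
have Fn : F n = 0%R.
  rewrite /F (eq_bigl xpredT) => [|j]; last exact: ltn_ord.
  rewrite -rmorph_sum; set N := (\sum_l _)%R in net *.
  have -> : N = (sgz N * k.+2%:Z)%R by rewrite -net -intEsg.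
  rewrite rmorphM /=; have -> : (k.+2%:Z%:~R = 0 :> 'I_k.+2)%R.
    exact: (pchar_Zp (p := k.+2)).
  by rewrite mulr0.
have F0 : F 0%N = 0%R by rewrite /F big_pred0.
have lev_next l : F (ordS l) = (F l + (step_sign d l)%:~R)%R.
  rewrite -FS /=; case: (ltngtP l.+1 n) (ltn_ord l) => // [lt_l|->] _.
    by rewrite modn_small.
  by rewrite modnn F0 Fn.
exists (fun i => F i) => l; have := lev_next l.
rewrite /step_head /step_tail /step_sign; case: (d l) => -> //.
by rewrite mulrN1z addrNK.
Qed.

Lemma arcs_noncrossing (V I : finType) (A lt : rel V) (v : I -> V)
    (tail head : I -> I) k (lev : I -> 'I_k.+2) :
  min_max_ordering A lt -> injective v ->
  (forall i j, A (v i) (v j) <-> exists l, i = tail l /\ j = head l) ->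
  (forall l, lev (head l) = lev (tail l) + 1)%R ->
  forall l m, lev (tail l) != lev (tail m) ->
  lt (v (tail l)) (v (tail m)) = lt (v (head l)) (v (head m)).
Proof.
move=> [[lt_irr lt_trans lt_tot] lt_mm] v_inj A_v lev_arc.
have lev_A i j : A (v i) (v j) -> lev j = (lev i + 1)%R.
  by case/A_v => l [-> ->].
have A_l l : A (v (tail l)) (v (head l)) by apply/A_v; exists l.
have lt_asym x y : lt x y -> lt y x -> False.
  by move=> xy /(lt_trans _ _ _ xy); rewrite lt_irr.
(* The arc from [tail l] to [head m] given by the Min-Max property forces [head m] one level above
   [tail l]. *)
have cross l m : lt (v (tail l)) (v (tail m)) ->
    lt (v (head m)) (v (head l)) -> lev (tail l) = lev (tail m).
  move=> lt_t lt_h; have [/lev_A + _] := lt_mm _ _ _ _ lt_t lt_h (A_l l) (A_l m).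
  by rewrite lev_arc => /addIr.
move=> l m ne_lev.
have ne_t : v (tail l) != v (tail m).
  by apply: contraNneq ne_lev => /v_inj ->.
have ne_h : v (head l) != v (head m).
  apply: contraNneq ne_lev => /v_inj eq_h; apply/eqP.
  by apply: (addIr 1%R); rewrite -!lev_arc eq_h.
case/orP: (lt_tot _ _ ne_t) => lt_t; case/orP: (lt_tot _ _ ne_h) => lt_h.
- by rewrite lt_t lt_h.
- by rewrite (cross l m) ?eqxx in ne_lev.
- by rewrite (cross m l) ?eqxx in ne_lev.
by apply/idP/idP => /lt_asym /(_ _) [].
Qed.

Theorem theorem3 (V : finType) (A : rel V) :
  (exists c : seq (V * bool),
     [/\ oriented_cycle A c, induced_cycle A c, unbalanced c
       & 1 < net_length c]) ->
  ~ (exists lt : rel V, min_max_ordering A lt).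
Proof.
case=> c [[c_neq0 c_uniq _ c_arcs] c_ind _ c_net] [lt lt_mm].
have [p0 i0] : (V * bool) * 'I_(size c).
  case: c c_neq0 {c_uniq c_arcs c_ind c_net} => // p c _.
  exact: (p, ord0).
pose v (i : 'I_(size c)) := (nth p0 c i).1.
pose d (i : 'I_(size c)) := (nth p0 c i).2.
have v_nth i : v i = nth p0.1 (cycle_verts c) i by rewrite (nth_map p0).
have v_inj : injective v.
  move=> i j /eqP; rewrite !v_nth nth_uniq ?size_map // => /eqP.
  exact: val_inj.
have A_v i j : A (v i) (v j) <->
    exists l, i = step_tail (@ordS _) d l /\ j = step_head (@ordS _) d l.
  split=> [Aij | [l [-> ->]]].
    have /(cycle_arcsP p0) [l [/v_inj -> /v_inj ->]] :
        (v i, v j) \in cycle_arcs c.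
      by apply: c_ind Aij; rewrite v_nth mem_nth ?size_map.
    by exists l.
  apply: (c_arcs (_, _)); apply/(cycle_arcsP p0).
  by exists l.
have [k net] : exists k, net_length c = k.+2.
  by case: (net_length c) c_net => [|[|k]] // _; exists k.
rewrite (net_lengthE p0) in net.
have [lev lev_arc] := exists_levels net.
have noncross := arcs_noncrossing lt_mm v_inj A_v lev_arc.
have [[lt_irr lt_trans lt_tot] _] := lt_mm.
set B := [pred l | lev (step_tail (@ordS _) d l) == (lev i0 + 1)%R].
have B_odd : odd #|B| by apply: odd_card_level net; first exact: ordS_inj.
pose gt l := lt (v i0) (v (step_tail (@ordS _) d l)).
have gt_even : ~~ odd #|[predI B & gt]|.
  apply: (odd_card_above (@ordS_inj _) lev_arc (r := fun i j => lt (v i) (v j))).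
  - exact: noncross.
  - by move=> i; apply: lt_irr.
  - by move=> j i l; apply: lt_trans.
  - exact: fconnect_ordS.
(* The reversed order also satisfies the noncrossing condition, so the same parity lemma counts the
   tails below [v i0]. *)
have lt_even : ~~ odd #|[predD B & gt]|.
  rewrite (eq_card (B := [pred l | (l \in B) &&
    lt (v (step_tail (@ordS _) d l)) (v i0)])).
    apply: (odd_card_above (@ordS_inj _) lev_arc (r := fun i j => lt (v j) (v i))).
    - by move=> l m ne_lev; apply: noncross; rewrite eq_sym.
    - by move=> i; apply: lt_irr.
    - by move=> j i l /[swap]; apply: lt_trans.
    - exact: fconnect_ordS.
  (* A tail one level above [i0] is not [v i0] itself, so by totality not being greater means being
     smaller. *)
  move=> l; rewrite !inE andbC unfold_in; case: eqP => //= lev_l.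
  have: v (step_tail (@ordS _) d l) != v i0.
    apply: contra_eqN lev_l => /eqP /v_inj ->.
    by rewrite -subr_eq0 opprD addNKr oppr_eq0 oner_eq0.
  move/lt_tot/orP => [lt_l|gt_l]; [rewrite lt_l | rewrite /gt gt_l].
    by apply/negP => /(lt_trans _ _ _ lt_l); rewrite lt_irr.
  by apply/esym/negP => /(lt_trans _ _ _ gt_l); rewrite lt_irr.
by move: B_odd; rewrite -(cardID gt B) oddD (negbTE gt_even) (negbTE lt_even).
Qed.
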